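(* Let $G=(V,E)$ be a connected finite graph with positive vertex measure $\mu$ and positive symmetric edge weights $w_{xy}$. Let $h_1,h_2:V\to\mathbb{R}$ be two given functions with $h_1(x)>0$ and $h_2(x)>0$ for all $x\in V$, and let $A,B>0$ be two constants. Let $\tilde{\mathbf{d}}_{h_1,h_2}$ be the topological degree (defined in the context) of the map $\mathcal{G}_{h_1,h_2}(u)=-\Delta u+h_1e^{Au}(e^{Au}-1)+h_2e^{-Bu}(e^{-Bu}-1)$. Then $$\tilde{\mathbf{d}}_{h_1,h_2}=0.$$
   Context: $G=(V,E)$ is a connected finite graph with measure $\mu:V\to(0,+\infty)$ and weights $\{w_{xy}:xy\in E\}$, where $w_{xy}=w_{yx}>0$. The Laplacian of $u:V\to\mathbb{R}$ is $$\Delta u(x)=\frac{1}{\mu(x)}\sum_{y\sim x}w_{xy}(u(y)-u(x)),$$ where $y\sim x$ means $xy\in E$. $L^\infty(V)$ is the finite-dimensional space of all functions $u:V\to\mathbb{R}$ with norm $\|u\|_\infty=\max_{x\in V}|u(x)|$ (identified with $\mathbb{R}^{V}$). Define $\mathcal{G}_{h_1,h_2}:L^\infty(V)\to L^\infty(V)$ by $$\mathcal{G}_{h_1,h_2}(u)(x)=-\Delta u(x)+h_1(x)e^{Au(x)}(e^{Au(x)}-1)+h_2(x)e^{-Bu(x)}(e^{-Bu(x)}-1).$$ Let $B_R=\{u\in L^\infty(V):\|u\|_\infty<R\}$. The Brouwer degree $\deg(\mathcal{G}_{h_1,h_2},B_R,0)$ is well-defined (no zero of the map on $\partial B_R$)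 for all sufficiently large $R$ and is then independent of $R$; the topological degree is $$\tilde{\mathbf{d}}_{h_1,h_2}=\lim_{R\to+\infty}\deg(\mathcal{G}_{h_1,h_2},B_R,0).$$ *)

(* Defs.v *)
From HB Require Import structures.
From mathcomp Require Import all_boot all_order all_algebra.
From mathcomp Require Import all_classical all_reals all_analysis.
Set Implicit Arguments.
Unset Strict Implicit.
Unset Printing Implicit Defensive.
Import Order.TTheory GRing.Theory Num.Theory.
Import numFieldNormedType.Exports.
Local Open Scope classical_set_scope.
Local Open Scope ring_scope.

Section brouwer_degree.
Context {R : realType} {n : nat}.
Implicit Types (f g : 'rV[R]_n -> 'rV[R]_n) (Omega : set 'rV[R]_n).
Implicit Types (p : 'rV[R]_n) (d : int).

Definition boundary Omega : set 'rV[R]_n := closure Omega `\` Omega°.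

Definition C1_in_cont_closure g Omega : Prop :=
  [/\ {within closure Omega, continuous g},
      forall x, Omega x -> differentiable g x &
      forall x, Omega x -> {for x, continuous (jacobian g)}].

Definition regular_value g Omega p : Prop :=
  forall x, Omega x -> g x = p -> \det (jacobian g x) != 0.

(* When [g] is C^1 on the bounded open set [Omega], continuous on its closure,
   [p] is a regular value and [p] is not attained on the boundary, the index
   set is compact and discrete, so this is a genuine finite sum of signs. *)
Definition regular_degree g Omega p : int :=
  \sum_(x \in Omega `&` g @^-1` [set p]) sgz (\det (jacobian g x)).

(* The graph of the Brouwer degree, deg(f, Omega, p) = d: [f] is continuous on
   the closure of the bounded open set [Omega], [p] is not in
   f(boundary Omega), and [d] is the sum of the signs of the Jacobian
   determinants at the preimages of [p] under a C^1 map [g] having [p] as a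
   regular value and uniformly closer to [f] than the distance from [p] to
   f(boundary Omega).  Such a [g] exists by Sard's theorem, and [d] does not
   depend on it by homotopy invariance. *)
Definition is_brouwer_degree f Omega p d : Prop :=
  [/\ open Omega /\ bounded_set Omega,
      {within closure Omega, continuous f},
      forall z, boundary Omega z -> f z != p &
      exists g, [/\ C1_in_cont_closure g Omega,
        forall x z, closure Omega x -> boundary Omega z ->
          `|g x - f x| < `|f z - p|,
        regular_value g Omega p &
        d = regular_degree g Omega p]].

(* lim_(r -> +oo) deg(f, B_r, 0) = d; the degree being an integer, convergence
   means that it is eventually equal to [d].  The norm on 'rV is the sup norm. *)
Definition is_topological_degree f d : Prop :=
  \forall r \near +oo, is_brouwer_degree f [set u | `|u| < r] 0 d.

End brouwer_degree.

Section graph.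
Context {R : realType} {V : finType}.

Definition graph_connected (e : rel V) : Prop :=
  (0 < #|V|)%N /\ forall x y, connect e x y.

Definition laplacian (e : rel V) (w : V -> V -> R) (mu : V -> R)
    (u : V -> R) (x : V) : R :=
  (mu x)^-1 * \sum_(y | e x y) w x y * (u y - u x).

Definition Gmap (e : rel V) (w : V -> V -> R) (mu : V -> R)
    (h1 h2 : V -> R) (A B : R) (u : V -> R) (x : V) : R :=
  - laplacian e w mu u x
  + h1 x * expR (A * u x) * (expR (A * u x) - 1)
  + h2 x * expR (- B * u x) * (expR (- B * u x) - 1).

(* A map on functions V -> R, read on R^#|V| through the enumeration of V. *)
Definition in_coords (F : (V -> R) -> V -> R) (v : 'rV[R]_#|V|) : 'rV[R]_#|V| :=
  \row_i F (fun x => v ord0 (enum_rank x)) (enum_val i).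

End graph.

(* Main.v *)
(* Summing [mu x * Gmap u x] over [x] kills the Laplacian, so only the
   nonlinearity remains; it is bounded below and tends to +oo as [u x] goes to
   +oo or -oo.  Hence a bound on [Gmap u] bounds [u] (the map is proper), and
   [Gmap u] never equals a sufficiently negative constant [- c].  For large
   balls, [|Gmap|] exceeds [c] on the boundary, so [Gmap + c], which has no
   zeros, computes the degree of [Gmap]. *)
Require Import Defs.
From HB Require Import structures.
From mathcomp Require Import all_boot all_order all_algebra.
From mathcomp Require Import all_classical all_reals all_analysis.
From mathcomp Require Import lra.
Set Implicit Arguments.
Unset Strict Implicit.
Unset Printing Implicit Defensive.
Import Order.TTheory GRing.Theory Num.Theory.
Import numFieldNormedType.Exports.
Local Open Scope classical_set_scope.
Local Open Scope ring_scope.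

(** * Calculus of real-valued C^1 functions on a normed space *)

Section continuously_differentiable.
Context {R : realType} {V : normedModType R}.
Implicit Types f g : V -> R.

(** Continuity of the differential is asked direction by direction: the entries of a Jacobian matrix
    are values of differentials at fixed basis vectors. *)
Definition C1 f :=
  (forall x, differentiable f x) /\ forall v, continuous (fun x => 'd f x v).

Lemma C1_cst (c : R) : C1 (cst c).
Proof.
split=> [x|v]; first exact: differentiable_cst.
rewrite (_ : (fun x => _) = cst 0); first by move=> x; exact: cvg_cst.
by apply/funext => x; rewrite diff_cst.
Qed.

Lemma C1D f g : C1 f -> C1 g -> C1 (f \+ g).
Proof.
move=> [df cf] [dg cg]; split=> [x|v]; first exact: differentiableD.
rewrite (_ : (fun x => _) = (fun x => 'd f x v) \+ (fun x => 'd g x v)).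
  by move=> x; apply: cvgD; [exact: cf|exact: cg].
by apply/funext => x; rewrite diffD.
Qed.

Lemma C1M f g : C1 f -> C1 g -> C1 (f \* g).
Proof.
move=> [df cf] [dg cg]; split=> [x|v]; first exact: differentiableM.
rewrite (_ : (fun x => _) =
    (fun x => f x * 'd g x v) \+ (fun x => g x * 'd f x v)).
  move=> x; apply: cvgD; apply: cvgM; [|exact: cg| |exact: cf].
    exact: differentiable_continuous.
  exact: differentiable_continuous.
by apply/funext => x; rewrite diffM.
Qed.

Lemma C1Z k f : C1 f -> C1 (fun x => k * f x).
Proof. exact: (C1M (C1_cst k)). Qed.

Lemma C1N f : C1 f -> C1 (fun x => - f x).
Proof.
move=> C1f; under eq_fun do rewrite -mulN1r.
exact: C1Z.
Qed.

Lemma C1_sum (I : Type) (s : seq I) (P : pred I) (F : I -> V -> R) :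
  (forall i, C1 (F i)) -> C1 (fun x => \sum_(i <- s | P i) F i x).
Proof.
move=> C1F; elim: s => [|i s IH].
  rewrite (_ : (fun x => _) = cst 0); first exact: C1_cst.
  by apply/funext => x; rewrite big_nil.
under eq_fun do rewrite big_cons.
by case: (P i) => //; exact: (C1D (C1F i) IH).
Qed.

Lemma C1_expR f : C1 f -> C1 (expR \o f).
Proof.
move=> [df cf].
have dexp y : differentiable (@expR R) y.
  exact/derivable1_diffP/derivable_expR.
split=> [x|v]; first exact: differentiable_comp.
rewrite (_ : (fun x => _) = (fun x => expR (f x) * 'd f x v)).
  move=> x; apply: cvgM; last exact: cf.
  apply: continuous_comp; first exact: differentiable_continuous.
  exact: continuous_expR.
apply/funext => x; rewrite diff_comp //= diff1E // derive1E.
by rewrite derive_val mulrC.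
Qed.

End continuously_differentiable.

(** * Entrywise limits and differentials of matrix-valued maps *)

Section matrix_valued.
Context {R : realType} {V : normedModType R} {m n : nat}.

(** The norm is a maximum over finitely many entries, so the eventual bounds on the entries hold
    simultaneously. *)
Lemma cvg_mx (T : Type) (F : set_system T) {FF : Filter F}
    (M : T -> 'M[R]_(m, n)) (L : 'M[R]_(m, n)) :
  (forall i j, M x i j @[x --> F] --> L i j) -> M x @[x --> F] --> L.
Proof.
move=> ML; apply/cvgrPdist_le => /= e e0; near=> x.
rewrite /Num.Def.normr /= mx_normrE (bigmax_le _ (ltW e0)) //= => i _.
rewrite !mxE; move: i; near: x; apply: filter_forall => -[i j] /=.
by move/cvgrPdist_le : (ML i j) => /(_ _ e0).
Unshelve. all: by end_near. Qed.

Lemma differentiable_mx (M : V -> 'M[R]_(m, n)) (x : V) :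
  (forall i j, differentiable (fun v => M v i j) x) -> differentiable M x.
Proof.
move=> dM; rewrite (_ : M =
    \sum_(i < m) \sum_(j < n) fun v => M v i j *: delta_mx i j).
  do 2 apply: differentiable_sum => ?.
  exact: differentiableZl.
apply/funext => v; rewrite [LHS]matrix_sum_delta fct_sumE.
by apply: eq_bigr => i _; rewrite fct_sumE.
Qed.

Lemma diff_mxE (M : V -> 'M[R]_(m, n)) (x v : V) i j : differentiable M x ->
  ('d M x v) i j = 'd (fun u => M u i j) x v.
Proof.
move=> dM; have dMij : differentiable (fun u => M u i j) x.
  exact: (differentiable_comp dM (differentiable_coord _ _ _)).
by rewrite -!deriveE // derive_mx ?mxE //; exact: diff_derivable.
Qed.

End matrix_valued.

(** * Jacobians, and a criterion for the degree to vanish *)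

Section degree.
Context {R : realType} {n : nat}.
Implicit Types f : 'rV[R]_n -> 'rV[R]_n.

Lemma C1_coord (j : 'I_n) : C1 (fun v : 'rV[R]_n => v ord0 j).
Proof.
split=> [x|v]; first exact: differentiable_coord.
suff -> : (fun x => 'd (fun u : 'rV[R]_n => u ord0 j) x v) = cst (v ord0 j).
  exact: cst_continuous.
(* A coordinate is an entry of the identity map, whose differential is the identity. *)
apply/funext => x; rewrite -(@diff_mxE _ _ _ _ id x v ord0 j) //.
by rewrite diff_val.
Qed.

Lemma C1_differentiable f x :
  (forall j, C1 (fun v => f v ord0 j)) -> differentiable f x.
Proof.
move=> C1f; apply: differentiable_mx => k l; rewrite (ord1 k).
exact: (C1f l).1.
Qed.

Lemma continuous_jacobian f :
  (forall j, C1 (fun v => f v ord0 j)) -> continuous (jacobian f).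
Proof.
move=> C1f x; apply: (@cvg_mx _ _ _ _ (nbhs x)) => i j.
have df y := C1_differentiable y C1f.
rewrite (_ : (fun y => _) =
    (fun y => 'd (fun u => f u ord0 j) y (delta_mx 0 i))).
  rewrite mxE diff_mxE //; exact: (C1f j).2.
by apply/funext => y; rewrite mxE diff_mxE.
Qed.

(** The translate [f + c] lies at constant distance [|c|] from [f], and properness makes [|f|]
    exceed [|c|] on large spheres; so the translate is an admissible approximation, and its fibre
    over 0 is empty. *)
Lemma topological_degree_proper_missing_value f (c : 'rV[R]_n) :
  (forall j, C1 (fun v => f v ord0 j)) ->
  (forall t, exists r, forall v, `|f v| <= t -> `|v| <= r) ->
  (forall v, f v + c != 0) ->
  is_topological_degree f 0.
Proof.
move=> C1f fproper fc0.
pose g v := f v + c.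
have C1g j : C1 (fun v => g v ord0 j).
  rewrite (_ : (fun v => _) = (fun v => f v ord0 j) \+ cst (c ord0 j)).
    exact: (C1D (C1f j) (C1_cst _)).
  by apply/funext => v; rewrite /= mxE.
have [r0 fr0] := fproper `|c|.
near=> r.
have Bopen : open [set u : 'rV[R]_n | `|u| < r].
  rewrite (_ : mkset _ = ball (0 : 'rV[R]_n) r); first exact: ball_open.
  by rewrite -ball_normE; apply/seteqP; split=> u /=; rewrite sub0r normrN.
have cf z : boundary [set u : 'rV[R]_n | `|u| < r] z -> `|c| < `|f z|.
  (* The ball is open, so its boundary points satisfy [r <= |z|]; [|f z| <= |c|] would force
     [|z| <= r0 < r]. *)
  rewrite /boundary (interior_id _).1 // => -[_ /= /negP]; rewrite -leNgt => rz.
  rewrite ltNge; apply/negP => /fr0 zr0; suff : r0 < r by lra.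
  by near: r; exact: nbhs_pinfty_gt (num_real _).
split.
- split=> //; exists r; split; first exact: num_real.
  by move=> s rs u /= ur; apply: ltW; exact: lt_trans rs.
- apply: continuous_subspaceT => x.
  exact/differentiable_continuous/C1_differentiable.
- by move=> z /cf cfz; rewrite -normr_gt0; exact: le_lt_trans cfz.
exists g; split.
- split=> [|x _|x _]; last exact: continuous_jacobian.
    apply: continuous_subspaceT => x.
    exact/differentiable_continuous/C1_differentiable.
  exact: C1_differentiable.
- by move=> x z _ /cf; rewrite /g addrAC subrr add0r subr0.
- by move=> x _ gx0; move/eqP : gx0 (fc0 x) => ->.
rewrite /regular_degree (_ : _ `&` _ = set0) ?fsbig_set0 //.
by apply/seteqP; split=> // x [_ /= gx0]; move/eqP : gx0 (fc0 x) => ->.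
Unshelve. all: by end_near. Qed.

End degree.

(* [a * (a - 1) >= a - 1 >= ln a] *)
Lemma expR_mul_subr1_ge (R : realType) (s : R) : s <= expR s * (expR s - 1).
Proof.
have := expR_ge1Dx s; have := sqr_ge0 (expR s - 1); rewrite expr2; nra.
Qed.

(** With [a = expR s > 0], [a * (a - 1) = (a - 1)^2 + a - 1 > -1]. *)
Lemma expR_mul_subr1_gtN1 (R : realType) (s : R) :
  -1 < expR s * (expR s - 1).
Proof.
have := expR_gt0 s; have := sqr_ge0 (expR s - 1); rewrite expr2; nra.
Qed.

Lemma mx_norm_coord_le (R : realType) n (v : 'rV[R]_n) i : `|v ord0 i| <= `|v|.
Proof.
by rewrite [leRHS]/Num.Def.normr /= mx_normrE (le_bigmax _ _ (ord0, i)).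
Qed.

Lemma in_coords_rank (R : realType) (V : finType)
    (F : (V -> R) -> V -> R) v x :
  in_coords F v ord0 (enum_rank x) = F (fun y => v ord0 (enum_rank y)) x.
Proof. by rewrite mxE enum_rankK. Qed.

(** * The map on the graph: cancellation of the Laplacian, lower bounds, properness *)

Section mean_field.
Context {R : realType} {V : finType}.
Variables (e : rel V) (mu : V -> R) (w : V -> V -> R) (h1 h2 : V -> R).
Variables (A B : R).
Hypotheses (e_sym : symmetric e) (mu_gt0 : forall x, 0 < mu x).
Hypothesis w_sym : forall x y, e x y -> w x y = w y x.
Hypotheses (h1_gt0 : forall x, 0 < h1 x) (h2_gt0 : forall x, 0 < h2 x).
Hypotheses (A_gt0 : 0 < A) (B_gt0 : 0 < B).

Lemma sum_laplacian (u : V -> R) : \sum_x mu x * laplacian e w mu u x = 0.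
Proof.
pose S := \sum_x \sum_(y | e x y) w x y * (u y - u x).
have -> : \sum_x mu x * laplacian e w mu u x = S.
  by apply: eq_bigr => x _; rewrite mulVKf // gt_eqF.
(* Exchanging the endpoints of each edge keeps the symmetric weight and reverses the difference. *)
suff : S = - S by lra.
rewrite {1}/S (exchange_big_dep predT) //= /S -sumrN; apply: eq_bigr => x _.
rewrite -sumrN; apply: eq_big => [y|y eyx]; first by rewrite e_sym.
by rewrite w_sym // -mulrN opprB.
Qed.

Definition nonlinearity x s :=
  h1 x * expR (A * s) * (expR (A * s) - 1)
  + h2 x * expR (- B * s) * (expR (- B * s) - 1).

Lemma nonlinearity_gt x s : - (h1 x + h2 x) < nonlinearity x s.
Proof.
have := expR_mul_subr1_gtN1 (A * s); have := expR_mul_subr1_gtN1 (- B * s).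
rewrite /nonlinearity -!mulrA; have := h1_gt0 x; have := h2_gt0 x; nra.
Qed.

(** Linear growth as [s] tends to +oo: the first exponential term dominates its exponent, the second
    stays above [- h2 x]. The next lemma treats -oo with the roles exchanged. *)
Lemma nonlinearity_ge_pos x s : h1 x * (A * s) - h2 x <= nonlinearity x s.
Proof.
have := expR_mul_subr1_ge (A * s); have := expR_mul_subr1_gtN1 (- B * s).
rewrite /nonlinearity -!mulrA; have := h1_gt0 x; have := h2_gt0 x; nra.
Qed.

Lemma nonlinearity_ge_neg x s : h2 x * (- B * s) - h1 x <= nonlinearity x s.
Proof.
have := expR_mul_subr1_gtN1 (A * s); have := expR_mul_subr1_ge (- B * s).
rewrite /nonlinearity -!mulrA; have := h1_gt0 x; have := h2_gt0 x; nra.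
Qed.

Lemma sum_Gmap (u : V -> R) :
  \sum_x mu x * Gmap e w mu h1 h2 A B u x = \sum_x mu x * nonlinearity x (u x).
Proof.
rewrite -[LHS]addr0 -[X in _ + X = _](sum_laplacian u) -big_split /=.
apply: eq_bigr => x _; rewrite -mulrDr /Gmap /nonlinearity.
by congr (_ * _); lra.
Qed.

Lemma C1_Gmap_in_coords i :
  C1 (fun v => in_coords (Gmap e w mu h1 h2 A B) v ord0 i).
Proof.
pose u x (v : 'rV[R]_#|V|) := v ord0 (enum_rank x).
have C1u x : C1 (u x) by exact: C1_coord.
have C1exp k x : C1 (fun v => expR (k * u x v)).
  by apply: C1_expR; exact: C1Z.
have C1prod c k x : C1 (fun v => c * expR (k * u x v) * (expR (k * u x v) - 1)).
  by apply: C1M; [exact: C1Z|exact: (C1D (C1exp _ _) (C1_cst _))].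
under eq_fun do rewrite mxE.
(* Split off the two exponential terms; minus the Laplacian remains. *)
do 2 apply: (fun H => C1D H (C1prod _ _ _)).
apply: C1N.
apply: C1Z; apply: C1_sum => y; apply: C1Z.
exact: (C1D (C1u y) (C1N (C1u _))).
Qed.

(** The constant [c], a sum over all vertices, dominates every [h1 x + h2 x], so each
    [nonlinearity x (u x) + c] is positive; yet a value [- c] at every vertex would make their
    weighted sum zero. *)
Lemma Gmap_missing_value v : (0 < #|V|)%N ->
  in_coords (Gmap e w mu h1 h2 A B) v + const_mx (\sum_x (h1 x + h2 x)) != 0.
Proof.
move=> /card_gt0P[x0 _]; set c := \sum_x _; apply/eqP => Fc0.
pose u x := v ord0 (enum_rank x).
have Fc x : Gmap e w mu h1 h2 A B u x = - c.
  rewrite -in_coords_rank; move/rowP/(_ (enum_rank x)) : Fc0.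
  by rewrite !mxE; lra.
have : 0 < \sum_x mu x * (nonlinearity x (u x) + c).
  have pos x : 0 < mu x * (nonlinearity x (u x) + c).
    rewrite mulr_gt0 // -(subrr c) addrC ltrD2r.
    apply: le_lt_trans (nonlinearity_gt x (u x)).
    rewrite lerN2 /c (bigD1 x) //=.
    rewrite lerDl sumr_ge0 // => y _; exact/ltW/addr_gt0.
  (* The vertex [x0] makes the sum nonempty, hence strictly positive. *)
  rewrite (bigD1 x0) //= ltr_pwDl // sumr_ge0 // => y _; exact: ltW.
under eq_bigr do rewrite mulrDr.
rewrite big_split /= -sum_Gmap -big_split /= big1 ?ltxx // => x _.
by rewrite Fc mulrN addNr.
Qed.

Lemma Gmap_proper t : exists r, forall v,
  `|in_coords (Gmap e w mu h1 h2 A B) v| <= t -> `|v| <= r.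
Proof.
(* [K] bounds the weighted sum of the shifted nonlinearities once [Gmap u <= t] everywhere; [r x]
   then comes from solving the two linear lower bounds for [u x] and [- u x]. *)
pose K := \sum_x mu x * (t + (h1 x + h2 x)).
pose r x := `|K / mu x / (h1 x * A)| + `|K / mu x / (h2 x * B)|.
exists (\sum_x r x) => v vt; pose u x := v ord0 (enum_rank x).
(* After the shift by [h1 x + h2 x] all summands are positive, so a bound on the sum bounds each of
   them. *)
have fK x : mu x * (nonlinearity x (u x) + (h1 x + h2 x)) <= K.
  apply: (@le_trans _ _ (\sum_x mu x * (nonlinearity x (u x) + (h1 x + h2 x)))).
    rewrite (bigD1 x) //= lerDl sumr_ge0 // => y _.
    by apply/mulr_ge0; [exact: ltW|have := nonlinearity_gt y (u y); lra].
  rewrite /K; under eq_bigr do rewrite mulrDr.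
  under [leRHS]eq_bigr do rewrite mulrDr.
  rewrite !big_split /= lerD2r -sum_Gmap ler_sum // => y _.
  rewrite ler_pM2l // -in_coords_rank (le_trans _ vt) //.
  by rewrite (le_trans (ler_norm _)) ?mx_norm_coord_le.
have ur x : `|u x| <= r x.
  have {}fK : nonlinearity x (u x) + (h1 x + h2 x) <= K / mu x.
    by rewrite ler_pdivlMr // mulrC.
  have h1x := h1_gt0 x; have h2x := h2_gt0 x.
  have up : u x <= K / mu x / (h1 x * A).
    rewrite ler_pdivlMr ?mulr_gt0 //.
    by have := nonlinearity_ge_pos x (u x); lra.
  have lo : - u x <= K / mu x / (h2 x * B).
    rewrite ler_pdivlMr ?mulr_gt0 //.
    by have := nonlinearity_ge_neg x (u x); lra.
  have := ler_norm (K / mu x / (h1 x * A)).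
  have := ler_norm (K / mu x / (h2 x * B)).
  have := normr_ge0 (K / mu x / (h1 x * A)).
  have := normr_ge0 (K / mu x / (h2 x * B)).
  by rewrite ler_norml /r; lra.
have r_ge0 x : 0 <= r x by exact: le_trans (ur x).
(* The radii are nonnegative, so their sum bounds every coordinate and hence the sup norm. *)
rewrite /Num.Def.normr /= mx_normrE bigmax_le ?sumr_ge0 // => -[k j] _ /=.
rewrite (ord1 k) -(enum_valK j) (le_trans (ur _)) //.
by rewrite (bigD1 (enum_val j)) //= lerDl sumr_ge0.
Qed.

End mean_field.

Theorem theorem2 (R : realType) (V : finType) (e : rel V)
    (e_sym : symmetric e) (e_irr : irreflexive e) (e_conn : graph_connected e)
    (mu : V -> R) (mu_gt0 : forall x, 0 < mu x)
    (w : V -> V -> R) (w_sym : forall x y, e x y -> w x y = w y x)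
    (w_gt0 : forall x y, e x y -> 0 < w x y)
    (h1 h2 : V -> R) (h1_gt0 : forall x, 0 < h1 x) (h2_gt0 : forall x, 0 < h2 x)
    (A B : R) (A_gt0 : 0 < A) (B_gt0 : 0 < B) :
  is_topological_degree (in_coords (Gmap e w mu h1 h2 A B)) 0.
Proof.
have [V_gt0 _] := e_conn.
apply: topological_degree_proper_missing_value.
- by move=> j; exact: C1_Gmap_in_coords.
- by move=> t; exact: Gmap_proper.
- by move=> v; exact: Gmap_missing_value.
Qed.
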